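(* Let $X$ be a real-valued random variable and let $Y$ be an independent symmetrizer of $X$. (1) If $X\sim\mathrm{Exp}(\lambda)$ is an exponential random variable with $\lambda>0$, then for every Borel measurable set $A\subset\mathbb R$ of finite Lebesgue measure $|A|$, $$\mathbb P(Y\in A)\le 1-e^{-\lambda|A|}.$$ (2) If $X\sim\mathrm{Geom}(p)$ is a geometric random variable with $0<p<1$, $q=1-p$, and $Y$ is integer-valued, then for every finite subset $A\subset\mathbb Z$ of cardinality $|A|$, $$\mathbb P(Y\in A)\le 1-q^{|A|}.$$ In both (1) and (2), equality can be achieved by taking $Y$ to be an independent copy of $-X$ and suitable sets $A$.
   Context: A random variable $Y$ is an independent symmetrizer of a random variable $X$ if $Y$ is independent of $X$ and the distribution of $X+Y$ is symmetric about the origin (i.e. $X+Y$ and $-(X+Y)$ have the same distribution). $X\sim\mathrm{Exp}(\lambda)$ means that $X$ has density $f_X(x)=\lambda e^{-\lambda x}\mathbf 1_{[0,\infty)}(x)$. $X\sim\mathrm{Geom}(p)$ means that $X$ has probability mass function $f_X(k)=pq^k$ for $k\in\mathbb Z_{\ge 0}$, where $q=1-p$. *)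

(* Defs.v *)
From HB Require Import structures.
From mathcomp Require Import all_boot all_order all_algebra finmap.
From mathcomp Require Import all_classical all_reals all_analysis measurable_realfun.

Set Implicit Arguments.
Unset Strict Implicit.
Unset Printing Implicit Defensive.

Import Order.TTheory GRing.Theory Num.Theory.
Import numFieldNormedType.Exports.

Local Open Scope classical_set_scope.
Local Open Scope ring_scope.

Definition independent_rv d (T : measurableType d) (R : realType)
    (P : probability T R) (X Y : {RV P >-> R}) : Prop :=
  forall A B : set R, measurable A -> measurable B ->
    P (X @^-1` A `&` Y @^-1` B) = (P (X @^-1` A) * P (Y @^-1` B))%E.

(* The equality is required on Borel sets only: [distribution P X] is a total
   function on [set R], with no meaningful value on non-measurable sets. *)
Definition same_distribution d (T : measurableType d) (R : realType)
    (P : probability T R) (X Y : {RV P >-> R}) : Prop :=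
  forall A : set R, measurable A -> distribution P X A = distribution P Y A.

Definition symmetric_rv d (T : measurableType d) (R : realType)
    (P : probability T R) (X : {RV P >-> R}) : Prop :=
  same_distribution X (\- X : {RV P >-> R}).

Definition independent_symmetrizer d (T : measurableType d) (R : realType)
    (P : probability T R) (X Y : {RV P >-> R}) : Prop :=
  independent_rv X Y /\
  symmetric_rv (X \+ Y : {RV P >-> R}).

Definition independent_copy_opp d (T : measurableType d) (R : realType)
    (P : probability T R) (X Y : {RV P >-> R}) : Prop :=
  independent_rv X Y /\ same_distribution Y (\- X : {RV P >-> R}).

(* [exponential_prob lambda] integrates [exponential_pdf lambda], which is
   [lambda * expR (- lambda * x)] on [0, +oo[ and 0 elsewhere. *)
Definition exponential_rv d (T : measurableType d) (R : realType)
    (P : probability T R) (X : {RV P >-> R}) (lambda : R) : Prop :=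
  forall A : set R, measurable A ->
    distribution P X A = exponential_prob lambda A.

(* For 0 < p < 1 the masses p (1 - p) ^ k add up to 1, so X almost surely takes
   its values in the natural numbers and its law is determined. *)
Definition geometric_rv d (T : measurableType d) (R : realType)
    (P : probability T R) (X : {RV P >-> R}) (p : R) : Prop :=
  forall k : nat, pmf X k%:R = p * (1 - p) ^+ k.

Definition integer_valued d (T : measurableType d) (R : realType)
    (P : probability T R) (Y : {RV P >-> R}) : Prop :=
  {ae P, forall w, Y w \is a Num.int}.

(* Main.v *)
Require Import Defs.
From HB Require Import structures.
From mathcomp Require Import all_boot all_order all_algebra finmap.
From mathcomp Require Import all_classical all_reals all_analysis measurable_realfun.
From mathcomp Require Import ring lra.

Set Implicit Arguments.
Unset Strict Implicit.
Unset Printing Implicit Defensive.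

Import Order.TTheory GRing.Theory Num.Theory.
Import numFieldNormedType.Exports.

Local Open Scope classical_set_scope.
Local Open Scope ring_scope.

(** Write [W = X + Y].  Both laws are memoryless: past a level [h], the overshoot
    [X - h] has the law of [X], up to the factor [theta = P (h <= X)].  This
    passes to [W], whose law beyond [h <= X] is that of [W + h] times [theta].
    Two facts follow.  First, the tails of [|W|] decay no faster than those of
    [X] ([pr_outside_add]).  Second, for a set [S] symmetric about [h / 2] the
    symmetry of [W] gives
    [P (X < h, W \in S) = (1 - theta) * P (W \in S)] ([pr_reflection]): the
    event [W \in S] is, up to scaling, the event that [Y] plus a truncated copy
    of [X] lies in [S].  With [h = 1] in the geometric case, where the truncated
    copy is [0], [|Y - 1/2|] and [|W - 1/2|] have the same law
    ([geometric_symmetrizer_law]).  With [h] tending to [0] in the exponential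
    case, [|Y|] and [|W|] have the same law ([exponential_symmetrizer_law]).

    So [|Y|] has hazard rate at most [lambda], respectively each shell of
    [|Y - 1/2|] carries at most the fraction [p] of the mass from it outwards;
    the bounds hold for every variable of this kind.  Indeed, scan [A] by increasing radius.  The mass
    that [Y] puts on a slice of [A] is at most [lambda] times its measure times
    the mass that lies further out, and the latter is at most the part [1 - m]
    not yet captured by [A].  Thus [1 - m] decreases at rate at most [lambda]
    per unit of measure of [A], whence
    [1 - P (Y \in A) >= expR (- lambda * |A|)] ([hazard_bound]); in the discrete
    case each shell meeting [A] costs a factor at most [q]
    ([shell_hazard_bound]).

    If [Y] is an independent copy of [- X] then [(X, Y)] and [(- Y, - X)] have the
    same law, so [Y] is a symmetrizer, and the sets [[- a, 0]] and
    [{- (n - 1), ..., 0}] attain equality. *)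

(** * Joint laws of pairs of random variables *)

Lemma finite_measure_prod_ext d1 d2 (T1 : measurableType d1)
    (T2 : measurableType d2) (R : realType)
    (m1 m2 : {measure set (T1 * T2) -> \bar R}) :
  (m1 setT < +oo)%E ->
  (forall A B, measurable A -> measurable B -> m1 (A `*` B) = m2 (A `*` B)) ->
  forall C, measurable C -> m1 C = m2 C.
Proof.
move=> m1fin m12 C mC.
pose G : set (set (T1 * T2)) :=
  [set C | exists A, measurable A /\ exists B, measurable B /\ C = A `*` B].
apply: (measure_unique G (fun=> setT)) => //.
- rewrite measurable_prod_measurableType //; congr (<<s _ >>).
  rewrite predeqE; split => [[A mA [B mB <-]]|[A [mA [B [mB ->]]]]].
    by exists A; split => //; exists B.
  by exists A => //; exists B.
- move=> /= _ _ [A1 [mA1 [B1 [mB1 ->]]]] [A2 [mA2 [B2 [mB2 ->]]]].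
  rewrite -setXI; exists (A1 `&` A2); split; first exact: measurableI.
  by exists (B1 `&` B2); split => //; exact: measurableI.
- by move=> _; exists setT; split => //; exists setT; split; rewrite ?setXTT.
- by rewrite bigcup_const.
- by move=> _ [A [mA [B [mB ->]]]]; exact: m12.
Qed.

Lemma measurable_shift (R : realType) (S : set R) (h : R) :
  measurable S -> measurable [set x : R | S (x - h)].
Proof.
move=> mS; rewrite -[X in measurable X]setTI.
suff: measurable_fun setT (fun x : R => x - h) by apply.
by apply: measurable_funB.
Qed.

Lemma measurable_opp (R : realType) (S : set R) :
  measurable S -> measurable [set x : R | S (- x)].
Proof.
move=> mS; rewrite -[X in measurable X]setTI.
suff: measurable_fun setT (fun x : R => - x) by apply.
exact: measurable_funN.
Qed.

Lemma measurable_sum (R : realType) (S : set R) :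
  measurable S -> measurable [set z : R * R | S (z.1 + z.2)].
Proof.
move=> mS; rewrite -[X in measurable X]setTI.
suff: measurable_fun setT (fun z : R * R => z.1 + z.2) by apply.
by apply: measurable_funD.
Qed.

Section Probabilities.
Context {d : measure_display} {T : measurableType d} {R : realType}.
Variable P : probability T R.
Implicit Types X Y : {RV P >-> R}.

Definition pr (A : set T) : R := fine (P A).

Lemma prK A : measurable A -> P A = (pr A)%:E.
Proof. by move=> mA; rewrite fineK ?fin_num_measure. Qed.

Lemma pr_ge0 A : 0 <= pr A. Proof. by rewrite fine_ge0. Qed.

Lemma pr_setT : pr setT = 1. Proof. by rewrite /pr probability_setT. Qed.

Lemma pr_set0 : pr set0 = 0. Proof. by rewrite /pr measure0. Qed.

Lemma le_pr A B : measurable A -> measurable B -> A `<=` B -> pr A <= pr B.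
Proof.
by move=> mA mB AB; rewrite fine_le ?fin_num_measure// le_measure// inE.
Qed.

Lemma pr_le1 A : measurable A -> pr A <= 1.
Proof. by move=> mA; rewrite -pr_setT le_pr. Qed.

Lemma prU A B : measurable A -> measurable B -> A `&` B = set0 ->
  pr (A `|` B) = pr A + pr B.
Proof.
by move=> mA mB AB; rewrite /pr measureU// fineD ?fin_num_measure.
Qed.

Lemma prID (A B : set T) : measurable A -> measurable B ->
  pr A = pr (A `&` B) + pr (A `&` ~` B).
Proof.
move=> mA mB; rewrite -prU.
- by rewrite -setIUr setUv setIT.
- exact: measurableI.
- by apply: measurableI => //; exact: measurableC.
- by rewrite setIACA setICr setI0.
Qed.

Lemma le_prU A B C : measurable A -> measurable B -> measurable C ->
  C `<=` A `|` B -> pr C <= pr A + pr B.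
Proof.
move=> mA mB mC CAB; rewrite (prID mC mA) lerD// le_pr//.
- exact: measurableI.
- by apply: measurableI => //; exact: measurableC.
- by move=> w [/CAB[]].
Qed.

Lemma measurable_pre (f : {RV P >-> R}) (S : set R) :
  measurable S -> measurable (f @^-1` S).
Proof. exact: measurable_funPTI. Qed.

Lemma measurable_preI (f g : {RV P >-> R}) (S U : set R) :
  measurable S -> measurable U -> measurable (f @^-1` S `&` g @^-1` U).
Proof. by move=> mS mU; apply: measurableI; exact: measurable_pre. Qed.


(** Rectangles generate the product sigma-algebra, so a relation between two
    pairs of variables that is proportional on rectangles propagates to every
    event about the pairs, in particular to events about their sums. *)
Lemma pair_law_ext (X1 Y1 X2 Y2 : {RV P >-> R}) (D : set T) (theta : R) :
  measurable D -> 0 <= theta ->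
  (forall A B : set R, measurable A -> measurable B ->
    pr (D `&` (X1 @^-1` A `&` Y1 @^-1` B)) =
    theta * pr (X2 @^-1` A `&` Y2 @^-1` B)) ->
  forall C : set (R * R), measurable C ->
    pr (D `&` [set w | C (X1 w, Y1 w)]) =
    theta * pr [set w | C (X2 w, Y2 w)].
Proof.
move=> mD th0 rect C mC.
pose V X Y (w : T) : R * R := (X w, Y w).
have mV (X Y : {RV P >-> R}) : measurable_fun setT (V X Y).
  by apply: measurable_fun_pair.
pose th := NngNum th0.
pose m1 : {measure set (R * R) -> \bar R} :=
  pushforward (mrestr P mD) (V X1 Y1).
pose m2 : {measure set (R * R) -> \bar R} :=
  pushforward (mscale th P) (V X2 Y2).
have m1E E : m1 (mV X1 Y1) E = P (V X1 Y1 @^-1` E `&` D) by [].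
have m2E E : m2 (mV X2 Y2) E = (theta%:E * P (V X2 Y2 @^-1` E))%E by [].
suff: m1 (mV X1 Y1) C = m2 (mV X2 Y2) C.
  rewrite m1E m2E /pr setIC => ->.
  rewrite fineM// fin_num_measure//.
  by rewrite -[X in measurable X](setTI); apply: (mV X2 Y2 measurableT C mC).
apply: finite_measure_prod_ext mC => [|A B mA mB].
  by rewrite m1E (le_lt_trans _ (ltry 1))// probability_le1// setTI.
rewrite m1E m2E setIC !prK.
- by rewrite -EFinM; congr (_%:E); exact: rect.
- exact: measurable_preI.
- by apply: measurableI => //; exact: measurable_preI.
Qed.

(** The common feature of the two laws: the overshoot of [h], on the event that
    [h] is reached, has the original law up to the factor [theta].  Exponential
    laws have it at every [h >= 0], geometric laws at [h = 1]. *)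
Definition memoryless_at X (h theta : R) :=
  forall S : set R, measurable S ->
    pr (X @^-1` `[h, +oo[ `&` X @^-1` [set x | S (x - h)]) =
    theta * pr (X @^-1` S).

(** Memorylessness survives the addition of an independent variable, because
    the pair [(X - h, Y)] on [h <= X] is [theta] times the pair [(X, Y)]. *)
Lemma independent_rvD_shift X Y h theta (S : set R) :
  independent_rv X Y -> memoryless_at X h theta -> 0 <= theta -> measurable S ->
  pr (X @^-1` `[h, +oo[ `&` (X \+ Y : {RV P >-> R}) @^-1` [set x | S (x - h)]) =
  theta * pr ((X \+ Y : {RV P >-> R}) @^-1` S).
Proof.
move=> indep mem th0 mS.
have mXh : (fun w => X w - h) \in mfun.
  by apply/mem_set; apply: measurable_funB.
pose Xh : {RV P >-> R} := mfun_Sub mXh.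
have := @pair_law_ext Xh Y X Y (X @^-1` `[h, +oo[) theta _ th0 _ _ (measurable_sum mS).
rewrite /= (_ : [set w | S (X w - h + Y w)] =
  (X \+ Y : {RV P >-> R}) @^-1` [set x | S (x - h)]); last first.
  by apply/seteqP; split=> w /=; rewrite addrAC.
apply=> [|A B mA mB]; first exact: measurable_pre.
have mA' := measurable_shift h mA.
rewrite setIA /pr (_ : _ `&` Xh @^-1` A =
  X @^-1` (`[h, +oo[ `&` [set x | A (x - h)])); last by [].
rewrite !indep//; last exact: measurableI.
have mX' : measurable (X @^-1` (`[h, +oo[ `&` [set x | A (x - h)])).
  by apply: measurable_pre; exact: measurableI.
rewrite !fineM ?fin_num_measure//; try exact: measurable_pre.
by rewrite mulrA; congr (_ * _); exact: mem.
Qed.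

End Probabilities.

(** * Symmetrizers of memoryless variables *)

Section Symmetrizers.
Context {d : measure_display} {T : measurableType d} {R : realType}.
Variable P : probability T R.
Implicit Types X Y Z : {RV P >-> R}.
Local Notation pr := (pr P).

Lemma symmetric_rv_pr Z (S : set R) : symmetric_rv Z -> measurable S ->
  pr (Z @^-1` [set x | S (- x)]) = pr (Z @^-1` S).
Proof. by move=> sym mS; rewrite /pr -[P (Z @^-1` S)]/(distribution P Z S) sym. Qed.

Lemma memoryless_at_pr_ge X h theta : memoryless_at X h theta ->
  pr (X @^-1` `[h, +oo[) = theta.
Proof. by move/(_ setT measurableT); rewrite !preimage_setT setIT pr_setT mulr1. Qed.

Lemma memoryless_at_pr_lt X h theta : memoryless_at X h theta ->
  pr (X @^-1` `]-oo, h[) = 1 - theta.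
Proof.
move=> mem; rewrite -(memoryless_at_pr_ge mem) -(pr_setT P).
rewrite (prID P measurableT (measurable_pre X (measurable_itv `[h, +oo[))).
rewrite !setTI [X in X - _]addrC addrK preimage_setC; congr (pr (_ @^-1` _)).
by rewrite setCitvr.
Qed.

(** With [W = X + Y], the part of [W \in S] where [h <= X] has probability
    [theta * P (W + h \in S)]; if [S] is symmetric about [h / 2] then
    [W + h \in S] means [- W \in S], which is as likely as [W \in S].
    Hence truncating [X] at [h] only rescales such events. *)
Lemma pr_reflection X Y h theta (S : set R) :
  independent_symmetrizer X Y -> memoryless_at X h theta -> 0 <= theta ->
  measurable S -> (forall x, S (h - x) <-> S x) ->
  pr (X @^-1` `]-oo, h[ `&` (X \+ Y : {RV P >-> R}) @^-1` S) =
  (1 - theta) * pr ((X \+ Y : {RV P >-> R}) @^-1` S).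
Proof.
move=> [indep sym] mem th0 mS refl; set W : {RV P >-> R} := X \+ Y.
have mSh : measurable [set x | S (x + h)].
  by have := measurable_shift (- h) mS; rewrite opprK.
have shift : pr (X @^-1` `[h, +oo[ `&` W @^-1` S) = theta * pr (W @^-1` S).
  rewrite -(symmetric_rv_pr sym mS).
  have : pr (X @^-1` `[h, +oo[ `&` W @^-1` [set x | S (x - h + h)]) =
      theta * pr (W @^-1` [set x | S (x + h)]).
    exact: independent_rvD_shift mSh.
  rewrite (_ : [set x | S (x - h + h)] = S); last first.
    by apply/seteqP; split=> x /=; rewrite subrK.
  move=> ->; congr (_ * pr (_ @^-1` _)); apply/seteqP.
  by split=> x /=; have := refl (- x); rewrite opprK addrC; case.
rewrite mulrBl mul1r -shift.
rewrite (prID P (measurable_pre W mS) (measurable_pre X (measurable_itv `[h, +oo[))).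
rewrite [X in pr X + _]setIC [X in X - _]addrC addrK setIC preimage_setC.
by rewrite setCitvr.
Qed.

Lemma pr_gt_addl X Y h theta (t : R) :
  independent_rv X Y -> memoryless_at X h theta -> 0 <= theta ->
  theta * pr ((X \+ Y : {RV P >-> R}) @^-1` `]t, +oo[) <=
  pr ((X \+ Y : {RV P >-> R}) @^-1` `]t + h, +oo[).
Proof.
move=> indep mem th0.
rewrite -(independent_rvD_shift indep mem th0 (measurable_itv _)).
apply: le_pr.
- apply: measurable_preI => //.
  by apply: measurable_shift; exact: measurable_itv.
- exact: measurable_pre.
- by move=> w [_] /=; rewrite !in_itv/= !andbT ltrBrDr.
Qed.

(** One-sided approximation of the level suffices, as survival functions are
    right-continuous. *)
Lemma pr_gt_right_cont Z (t c : R) :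
  (forall e, 0 < e -> pr (Z @^-1` `]t + e, +oo[) <= c) ->
  pr (Z @^-1` `]t, +oo[) <= c.
Proof.
move=> Zc; rewrite -lee_fin -prK; last exact: measurable_pre.
rewrite -[leLHS]/(ccdf Z t).
have /cvg_lim <- // := @ccdf_right_continuous _ _ _ P Z t.
apply: lime_le.
  by apply/cvg_ex; eexists; exact: (@ccdf_right_continuous _ _ _ P Z t).
near=> s; rewrite /ccdf /distribution /pushforward prK; last exact: measurable_pre.
rewrite lee_fin (_ : s = t + (s - t)); last by rewrite addrC subrK.
by apply: Zc; rewrite subr_gt0.
Unshelve. all: by end_near. Qed.

Definition outside (c t : R) : set R := [set x | t < `|x - c|].

Lemma measurable_outside c t : measurable (outside c t).
Proof.
rewrite (_ : outside c t = (fun x => `|x - c|) @^-1` `]t, +oo[).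
  rewrite -[X in measurable X]setTI.
  suff: measurable_fun setT (fun x : R => `|x - c|) by apply.
  by apply: measurableT_comp => //; apply: measurable_funB.
by apply/seteqP; split=> x; rewrite /outside /= in_itv/= andbT.
Qed.

Lemma pr_outside_right_cont Z (c t b : R) :
  (forall e, 0 < e -> pr (Z @^-1` outside c (t + e)) <= b) ->
  pr (Z @^-1` outside c t) <= b.
Proof.
have mf : (fun w => `|Z w - c|) \in mfun.
  apply/mem_set; apply: measurableT_comp => //.
  by apply: measurable_funB.
have E s : Z @^-1` outside c s = (mfun_Sub mf : {RV P >-> R}) @^-1` `]s, +oo[.
  by apply/seteqP; split=> x; rewrite /outside /= in_itv/= andbT.
by move=> Zb; rewrite E; apply: pr_gt_right_cont => e /Zb; rewrite E.
Qed.

Lemma pr_outside Z (c t : R) : symmetric_rv Z -> 0 <= t ->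
  pr (Z @^-1` outside c t) =
  pr (Z @^-1` `]t + c, +oo[) + pr (Z @^-1` `]t - c, +oo[).
Proof.
move=> sym t0.
rewrite -[X in _ + X](symmetric_rv_pr sym (measurable_itv _)) -prU.
- congr pr; rewrite -preimage_setU; congr (_ @^-1` _).
  apply/seteqP; split=> x; rewrite /outside /= !in_itv/= !andbT lter_normr.
    by case/orP => ?; [left|right]; lra.
  by case=> ?; apply/orP; [left|right]; lra.
- exact: measurable_pre.
- rewrite (_ : [set x | _] = `]-oo, c - t[%classic); first exact: measurable_pre.
  by apply/seteqP; split=> x; rewrite /= !in_itv/= ?andbT => ?; lra.
- rewrite -preimage_setI (_ : _ `&` _ = set0) ?preimage_set0//.
  rewrite -subset0 => x [] /=; rewrite !in_itv/= !andbT => ? ?.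
  by exfalso; lra.
Qed.

(** The hazard bound for [W = X + Y]: both tails of [W] are, by symmetry, right
    tails, and raising the level of a right tail by [h] costs at most the factor
    [theta], since one may ask [X] to overshoot [h] first. *)
Lemma pr_outside_add X Y h theta (c t : R) :
  independent_symmetrizer X Y -> memoryless_at X h theta -> 0 <= theta ->
  0 <= h -> 0 <= t ->
  theta * pr ((X \+ Y : {RV P >-> R}) @^-1` outside c t) <=
  pr ((X \+ Y : {RV P >-> R}) @^-1` outside c (t + h)).
Proof.
move=> [indep sym] mem th0 h0 t0.
rewrite !pr_outside ?addr_ge0// mulrDr lerD//.
  by rewrite addrAC; exact: pr_gt_addl.
by rewrite addrAC; exact: pr_gt_addl.
Qed.

(** The pairs [(X, Y)] and [(- Y, - X)] have the same law. *)
Lemma independent_copy_opp_symmetrizer X Y :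
  independent_copy_opp X Y -> independent_symmetrizer X Y.
Proof.
move=> [indep copy]; split=> //.
pose NX : {RV P >-> R} := \- X; pose NY : {RV P >-> R} := \- Y.
have copyE A : measurable A -> P (Y @^-1` A) = P (X @^-1` [set x | A (- x)]).
  exact: copy.
move=> S mS.
have := @pair_law_ext _ _ _ P X Y NY NX setT 1 measurableT ler01 _ _
  (measurable_sum mS).
rewrite setTI mul1r /distribution /pushforward.
rewrite !prK; try exact: measurable_pre.
move=> H; congr (_%:E); etransitivity; first apply: H.
  move=> A B mA mB; rewrite setTI mul1r /pr; congr fine.
  rewrite indep// setIC.
  have E := indep _ _ (measurable_opp mB) (measurable_opp mA).
  rewrite [RHS](_ : _ =
    P (X @^-1` [set x | B (- x)] `&` Y @^-1` [set x | A (- x)]))//.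
  rewrite E muleC (copyE B)// (copyE [set x | A (- x)]); last first.
    exact: measurable_opp.
  congr (_ * P _)%E; apply/seteqP; split=> w /=; by rewrite opprK.
by congr pr; apply/seteqP; split=> w /=; rewrite opprD addrC.
Qed.

End Symmetrizers.

(** * The geometric case *)

Definition natural_points {R : realType} : set R :=
  \bigcup_(k in [set: nat]) [set k%:R].

Lemma measurable_natural_points {R : realType} :
  measurable (natural_points : set R).
Proof. exact: bigcup_measurable. Qed.

Lemma measurable_int_fset {R : realType} (A : {fset int}) :
  measurable ([set k%:~R | k in [set` A]] : set R).
Proof.
have : finite_set ([set k%:~R | k in [set` A]] : set R).
  exact: finite_image (finite_fset A).
by move/finite_set_countable; exact: countable_measurable.
Qed.

Section Geometric.
Context {d : measure_display} {T : measurableType d} {R : realType}.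
Variable P : probability T R.
Implicit Types X Y Z : {RV P >-> R}.
Local Notation pr := (pr P).

Lemma pr_nat_atoms X (S : set R) : measurable S ->
  P (X @^-1` (S `&` natural_points)) =
  (\sum_(0 <= k <oo) P (X @^-1` (S `&` [set k%:R])))%E.
Proof.
move=> mS; rewrite setI_bigcupr preimage_bigcup measure_bigcup//=.
- by apply: eq_eseriesl => k; rewrite in_setT.
- by move=> k _; apply: measurable_pre; exact: measurableI.
- apply/trivIsetP => i j _ _ ij; rewrite -subset0 => w [] /= [_ ->] [_ /eqP].
  by rewrite eqr_nat (negbTE ij).
Qed.

Lemma geometric_atom X p (S : set R) k : geometric_rv X (p : R) ->
  P (X @^-1` (S `&` [set k%:R])) = (p * (1 - p) ^+ k * (k%:R \in S)%:R)%:E.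
Proof.
move=> geo; rewrite setIC set1I; case: ifPn => kS.
  by rewrite mulr1 -geo /pmf -/(pr _) -prK//; exact: measurable_pre.
by rewrite preimage_set0 measure0 mulr0.
Qed.

Lemma geometric_nat X p : 0 < p < 1 -> geometric_rv X (p : R) ->
  P (X @^-1` natural_points) = 1%E.
Proof.
move=> /andP[p0 p1] geo; rewrite -[natural_points]setTI pr_nat_atoms//.
under eq_eseriesr do rewrite (geometric_atom _ _ geo) in_setT mulr1.
apply: cvg_lim => //.
rewrite (_ : (fun n => _) = EFin \o series (geometric p (1 - p))); last first.
  by apply/funext => n /=; rewrite sumEFin.
apply: cvg_EFin; first by near=> n.
rewrite (_ : _ \o _ = series (geometric p (1 - p))); last by [].
have q1 : `|1 - p| < 1 by rewrite ger0_norm; lra.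
have := @cvg_geometric_series _ p _ q1.
by rewrite opprB addrCA subrr addr0 divff// gt_eqF.
Unshelve. all: by end_near. Qed.

Lemma geometric_series X p (S : set R) : 0 < p < 1 -> geometric_rv X (p : R) ->
  measurable S ->
  P (X @^-1` S) =
  (\sum_(0 <= k <oo) (p * (1 - p) ^+ k * (k%:R \in S)%:R)%:E)%E.
Proof.
move=> p01 geo mS; under eq_eseriesr do rewrite -(geometric_atom S _ geo).
rewrite -pr_nat_atoms//.
have mnat := @measurable_natural_points R.
rewrite !prK; try by apply: measurable_pre => //; exact: measurableI.
congr (_%:E); rewrite (prID P (measurable_pre X mS) (measurable_pre X mnat)).
rewrite -preimage_setI -[RHS]addr0; congr (_ + _); apply/eqP.
rewrite eq_le pr_ge0 andbT.
have : pr (~` (X @^-1` natural_points)) = 0.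
  have := prID P measurableT (measurable_pre X mnat).
  by rewrite !setTI pr_setT {1}/pr (geometric_nat p01 geo)/= => ?; lra.
move=> <-; apply: le_pr; last by move=> w [].
  by apply: measurableI; [|apply: measurableC]; exact: measurable_pre.
by apply: measurableC; exact: measurable_pre.
Qed.

Lemma geometric_memoryless X p : 0 < p < 1 -> geometric_rv X (p : R) ->
  memoryless_at X 1 (1 - p).
Proof.
move=> p01 geo S mS; have /andP[p0 p1] := p01.
have mS1 := measurable_shift 1 mS.
apply/EFin_inj; rewrite EFinM -!prK; try exact: measurable_pre.
  rewrite -preimage_setI !(geometric_series p01 geo)//; last exact: measurableI.
  have pq0 k (b : bool) : (0 <= (p * (1 - p) ^+ k * b%:R)%:E)%E.
    rewrite lee_fin; apply: mulr_ge0; last exact: ler0n.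
    by apply: mulr_ge0; [lra|apply: exprn_ge0; lra].
  rewrite nneseries_recl//.
  rewrite -(@nneseries_addn _ _ 1)//.
  rewrite memNset; last by move=> [] /=; rewrite in_itv/= ler10.
  rewrite mulr0 add0e -nneseriesZl; last by move=> k _; exact: pq0.
  apply: eq_eseriesr => k _; rewrite -EFinM addn1 exprS; congr (_%:E).
  rewrite (_ : (_ \in `[1, +oo[ `&` _) = (k%:R \in S)); first ring.
  apply/idP/idP; rewrite !inE /=.
    by case=> _; rewrite -natr1 addrK.
  by rewrite -natr1 addrK in_itv/= andbT; split=> //; rewrite lerDr.
by apply: measurableI; exact: measurable_pre.
Qed.

(** The reflection identity at [h = 1] with [theta = 1 - p]: the event [X < 1]
    is [X = 0] up to a null set, so [W \in S] there reads [Y \in S], and [X = 0]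
    has probability [p = 1 - theta]. *)
Lemma geometric_symmetrizer_law X Y (p : R) (S : set R) : 0 < p < 1 ->
  geometric_rv X p -> independent_symmetrizer X Y -> measurable S ->
  (forall x, S (1 - x) <-> S x) ->
  pr (Y @^-1` S) = pr ((X \+ Y : {RV P >-> R}) @^-1` S).
Proof.
move=> p01 geo symm mS refl; have /andP[p0 p1] := p01.
have mem := geometric_memoryless p01 geo.
have q0 : 0 <= 1 - p by lra.
have := pr_reflection symm mem q0 mS refl; set W : {RV P >-> R} := X \+ Y.
have X0 : pr (X @^-1` [set 0]) = p.
  by have := geo 0; rewrite /pmf -/(pr _) expr0 mulr1.
have mX0 : measurable (X @^-1` [set 0]) by exact: measurable_pre.
have mXlt : measurable (X @^-1` `]-oo, 1[) by exact: measurable_pre.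
have mWS : measurable (W @^-1` S) by exact: measurable_pre.
have mX0c := measurableC mX0.
have mE := measurableI _ _ mXlt mWS.
have -> : pr (X @^-1` `]-oo, 1[ `&` W @^-1` S) =
    pr (X @^-1` `]-oo, 1[ `&` W @^-1` S `&` X @^-1` [set 0]).
  rewrite [LHS](prID P mE mX0) -[RHS]addr0; congr (_ + _).
  apply/eqP; rewrite eq_le pr_ge0 andbT.
  have X0' : pr (X @^-1` `]-oo, 1[ `&` ~` (X @^-1` [set 0])) = 0.
    have := memoryless_at_pr_lt mem.
    rewrite (prID P mXlt mX0) (_ : _ `&` X @^-1` [set 0] = X @^-1` [set 0]).
      by rewrite X0; lra.
    by apply/seteqP; split=> w /=; [case|move=> ->; rewrite in_itv/= ltr01].
  rewrite -[leRHS]X0'; apply: le_pr; [exact: measurableI mE mX0c|exact: measurableI|].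
  by move=> w [[? _] ?]; split.
rewrite (_ : _ `&` _ = X @^-1` [set 0] `&` Y @^-1` S).
  rewrite /pr symm.1// fineM ?fin_num_measure//; last exact: measurable_pre.
  rewrite -/(pr _) -/(pr _) -/(pr _) X0 => E.
  by apply: (@mulfI _ p); [rewrite gt_eqF|rewrite E; ring].
apply/seteqP; split=> w /=.
  by move=> [[_ SW] Xw]; split=> //; move: SW; rewrite Xw add0r.
by move=> [Xw SY]; split=> //; split; rewrite Xw ?add0r// in_itv/= ltr01.
Qed.

(** The shells [n < |y - c| <= n + 1] are visited from the centre outwards.  A
    shell carries at most the fraction [1 - q] of the mass that lies beyond
    radius [n], and that mass is at most what [A] has not yet captured; so each
    shell that meets [A] multiplies the uncaptured mass by at least [q], and the
    other shells capture nothing. *)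
Lemma shell_hazard_bound Y (q c : R) (A : {fset int}) :
  0 < q <= 1 -> (forall k, k \in A -> k%:~R != c) ->
  (forall n : nat, q * pr (Y @^-1` outside c n%:R) <=
    pr (Y @^-1` outside c n.+1%:R)) ->
  pr (Y @^-1` [set k%:~R | k in [set` A]]) <= 1 - q ^+ #|` A|.
Proof.
move=> /andP[q0 q1] Ac hazard; have qge0 := ltW q0.
pose S : set R := [set k%:~R | k in [set` A]].
have mS : measurable S by exact: measurable_int_fset.
have mO n : measurable (outside c n) by exact: measurable_outside.
pose inner (n : nat) (k : int) := `|k%:~R - c| <= n%:R.
pose N n := count (inner n) (enum_fset A).
pose B n := S `\` outside c n%:R.
have mB n : measurable (B n) by exact: measurableD.
have innerP n : 1 - pr (Y @^-1` B n) >= q ^+ N n.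
  elim: n => [|n IHn].
    have -> : B 0 = set0.
      rewrite -subset0 => _ [[k /= kA <-]]; rewrite /outside /=.
      by rewrite normr_gt0 subr_eq0 (Ac _ kA).
    by rewrite preimage_set0 pr_set0 subr0 exprn_ile1.
  have NS : N n.+1 = (N n +
      count (fun k => inner n.+1 k && ~~ inner n k) (enum_fset A))%N.
    rewrite /N -!sum1_count (bigID (inner n)) /=; congr (_ + _)%N.
    apply: eq_bigl => k; rewrite andb_idl// => /le_trans; apply.
    by rewrite ler_nat.
  have [/hasP[k kA /andP[kn1 kn]]|] :=
      boolP (has (fun k => inner n.+1 k && ~~ inner n k) (enum_fset A)).
    have Nn : (N n < N n.+1)%N.
      rewrite NS -[ltnLHS]addn0 ltn_add2l -has_count.
      by apply/hasP; exists k => //; rewrite kn1.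
    apply: le_trans (_ : q * q ^+ N n <= _).
      by rewrite -exprS ler_wiXn2l.
    have mOn m : measurable (Y @^-1` outside c m%:R) by exact: measurable_pre.
    have TB : pr (Y @^-1` outside c n%:R) <= 1 - pr (Y @^-1` B n).
      rewrite lerBrDr -prU//; last 2 first.
      - exact: measurable_pre.
      - by rewrite -preimage_setI setICA setICr setI0 preimage_set0.
      by rewrite pr_le1//; apply: measurableU => //; exact: measurable_pre.
    have TD : pr (Y @^-1` (outside c n%:R `\` outside c n.+1%:R)) =
        pr (Y @^-1` outside c n%:R) - pr (Y @^-1` outside c n.+1%:R).
      rewrite (prID P (mOn n) (mOn n.+1)) -preimage_setI setIidr.
        by rewrite addrAC subrr add0r.
      by move=> x; rewrite /outside /=; apply: le_lt_trans; rewrite ler_nat.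
    have Bstep : pr (Y @^-1` B n.+1) <= pr (Y @^-1` B n) +
        pr (Y @^-1` (outside c n%:R `\` outside c n.+1%:R)).
      apply: le_prU; [exact: measurable_pre| |exact: measurable_pre|].
        by apply: measurable_pre; exact: measurableD.
      move=> w [Sw out]; have [?|?] := pselect (outside c n%:R (Y w)).
        by right.
      by left.
    by have := hazard n; nra.
  rewrite -all_predC => /allP shell; apply: le_trans (le_trans IHn _).
    by rewrite ler_wiXn2l// NS leq_addr.
  rewrite lerD2l lerN2 le_pr//; try exact: measurable_pre.
  move=> w [[k kA kw] /negP]; rewrite -kw -leNgt => kn.
  split; first by exists k.
  rewrite /outside /= -kw => kn'; have := shell k kA; rewrite /= /inner kn -ltNge.
  by rewrite kn'.
have [n An] : exists n : nat, forall k, k \in A -> inner n k.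
  suff [n An] : exists n : nat, forall k, k \in enum_fset A -> inner n k.
    by exists n.
  elim: (enum_fset A) => [|k s [n sn]]; first by exists 0.
  exists (maxn n (Num.truncn `|k%:~R - c|).+1) => j; rewrite inE => /predU1P[->|/sn].
    rewrite /inner; apply: ltW; apply: lt_le_trans (truncnS_gt _) _.
    by rewrite ler_nat leq_maxr.
  by rewrite /inner => /le_trans; apply; rewrite ler_nat leq_maxl.
have := innerP n; rewrite (_ : B n = S); last first.
  apply/seteqP; split=> [x []//|x Sx]; split => //.
  by case: Sx => k /An + <-; rewrite /inner /outside /= leNgt => /negP.
move=> h; rewrite lerBrDr addrC -lerBrDr; apply: le_trans h.
by rewrite ler_wiXn2l// count_size.
Qed.

Lemma geometric_symmetrizer_bound X Y (p : R) (A : {fset int}) : 0 < p < 1 ->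
  geometric_rv X p -> independent_symmetrizer X Y ->
  pr (Y @^-1` [set k%:~R | k in [set` A]]) <= 1 - (1 - p) ^+ #|` A|.
Proof.
move=> p01 geo symm; have /andP[p0 p1] := p01.
apply: (@shell_hazard_bound _ _ 2^-1); first by apply/andP; split; lra.
  (* integers differ from the centre [1 / 2] *)
  move=> k _; apply/eqP => k2; have : (k * 2)%:~R = 1%:~R :> R.
    by rewrite intrM k2 mulVf.
  by move/eqP; rewrite eqr_int; case: (k) => [[|[|m]]|m].
have refl t x : outside (2^-1 : R) t (1 - x) <-> outside 2^-1 t x.
  rewrite /outside /= (_ : 1 - x - 2^-1 = - (x - 2^-1)) ?normrN//.
  by field.
move=> n; rewrite !(geometric_symmetrizer_law p01 geo symm)//;
  try exact: measurable_outside.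
have mem := geometric_memoryless p01 geo.
have q0 : 0 <= 1 - p by lra.
have := pr_outside_add 2^-1 symm mem q0 ler01 (ler0n _ n).
by rewrite natr1.
Qed.

End Geometric.

(** * Exponential variables are memoryless *)

Section Exponential.
Context {d : measure_display} {T : measurableType d} {R : realType}.
Variable P : probability T R.
Implicit Types X Y Z : {RV P >-> R}.
Local Notation pr := (pr P).

Lemma law_ext_rays (Z1 Z2 : {RV P >-> R}) (D : set T) (theta : R) :
  measurable D -> 0 <= theta ->
  (forall x, pr (D `&` Z1 @^-1` `[x, +oo[) = theta * pr (Z2 @^-1` `[x, +oo[)) ->
  forall S : set R, measurable S ->
    pr (D `&` Z1 @^-1` S) = theta * pr (Z2 @^-1` S).
Proof.
move=> mD th0 rays S mS.
pose th := NngNum th0.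
pose m1 : {measure set R -> \bar R} := pushforward (mrestr P mD) Z1.
pose m2 : {measure set R -> \bar R} := pushforward (mscale th P) Z2.
have mZ (Z : {RV P >-> R}) : measurable_fun setT Z by [].
have m1E E : measurable E -> m1 (mZ Z1) E = (pr (D `&` Z1 @^-1` E))%:E.
  move=> mE; rewrite -prK; last by apply: measurableI => //; exact: measurable_pre.
  by rewrite setIC.
have m2E E : measurable E -> m2 (mZ Z2) E = (theta * pr (Z2 @^-1` E))%:E.
  by move=> mE; rewrite EFinM -prK//; exact: measurable_pre.
apply/EFin_inj; rewrite -m1E// -m2E//.
apply: (measure_unique (@RGenCInfty.G R) (fun k => `[- k%:R, +oo[%classic)) => //.
- exact: RGenCInfty.measurableE.
- move=> _ _ [x ->] [y ->]; exists (Num.max x y).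
  by apply/seteqP; split=> z /=; rewrite !in_itv/= !andbT ge_max => /andP.
- by move=> k; exists (- k%:R).
- rewrite -subTset => x _; exists (Num.truncn `|x|).+1 => //=.
  rewrite in_itv/= andbT lerNl; apply: ltW; apply: le_lt_trans (truncnS_gt _).
  by rewrite -normrN ler_norm.
- by move=> _ [x ->]; rewrite m1E// m2E// rays.
- by move=> k; rewrite m1E// ltry.
Qed.

Lemma exponential_lt0 X (lambda : R) : exponential_rv X lambda ->
  pr (X @^-1` `]-oo, 0[) = 0.
Proof.
move=> expX; rewrite /pr -[P _]/(distribution P X `]-oo, 0[) expX//.
rewrite /exponential_prob integral0_eq// => x /=.
by rewrite in_itv/= => x0; rewrite lt0_exponential_pdf.
Qed.

Lemma exponential_atomless X (lambda x : R) : exponential_rv X lambda ->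
  pr (X @^-1` [set x]) = 0.
Proof.
move=> expX; rewrite /pr -[P _]/(distribution P X [set x]) expX//.
by rewrite /exponential_prob integral_set1.
Qed.

Lemma exponential_segment X (lambda x : R) : exponential_rv X lambda ->
  0 <= x -> pr (X @^-1` `[0, x]) = 1 - expR (- lambda * x).
Proof.
move=> expX; rewrite le_eqVlt => /predU1P[<-|x0].
  by rewrite set_itv1 (exponential_atomless _ expX) mulr0 expR0 subrr.
rewrite /pr -[P _]/(distribution P X `[0, x]) expX//.
by rewrite exponential_prob_itv0c.
Qed.

Lemma exponential_tail X (lambda x : R) : exponential_rv X lambda ->
  pr (X @^-1` `[x, +oo[) = expR (- lambda * Num.max x 0).
Proof.
move=> expX.
have split1 : pr (X @^-1` `]-oo, x[) + pr (X @^-1` `[x, +oo[) = 1.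
  rewrite -prU; try exact: measurable_pre.
    by rewrite -preimage_setU setUC -setCitvr setUv preimage_setT pr_setT.
  by rewrite -preimage_setI -setCitvr setICl preimage_set0.
suff : pr (X @^-1` `]-oo, x[) = 1 - expR (- lambda * Num.max x 0) by lra.
have X0 := exponential_lt0 expX.
have [x0|x0] := leP x 0.
  rewrite mulr0 expR0 subrr; apply/eqP; rewrite eq_le pr_ge0 andbT.
  rewrite -[leRHS]X0; apply: le_pr; try exact: measurable_pre.
  by move=> w /=; rewrite !in_itv/= => /lt_le_trans; apply.
have lower : pr (X @^-1` `]-oo, x[) <=
    pr (X @^-1` `[0, x]) + pr (X @^-1` `]-oo, 0[).
  apply: le_prU; try exact: measurable_pre.
  move=> w /=; rewrite !in_itv/= => wx.
  by have [w0|w0] := leP 0 (X w); [left; rewrite ltW|right].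
have upper : pr (X @^-1` `[0, x]) <=
    pr (X @^-1` `]-oo, x[) + pr (X @^-1` [set x]).
  apply: le_prU; try exact: measurable_pre.
  move=> w /=; rewrite !in_itv/= => /andP[_].
  by rewrite le_eqVlt => /predU1P[?|?]; [right|left].
move: lower upper; rewrite X0 (exponential_atomless _ expX).
by rewrite (exponential_segment expX (ltW x0)); lra.
Qed.

Lemma exponential_memoryless X (lambda h : R) : exponential_rv X lambda ->
  0 <= h -> memoryless_at X h (expR (- lambda * h)).
Proof.
move=> expX h0 S mS.
have mXh : (fun w => X w - h) \in mfun.
  by apply/mem_set; apply: measurable_funB.
apply: (@law_ext_rays (mfun_Sub mXh) X); rewrite ?expR_ge0//.
  exact: measurable_pre.
move=> x; rewrite (_ : _ `&` _ = X @^-1` `[Num.max h (x + h), +oo[).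
  rewrite !(exponential_tail _ expX) -expRD -mulrDr; congr (expR (_ * _)).
  have [|] := leP x 0; have [|] := leP h (x + h); have [|] := leP h 0;
    have [|] := leP (x + h) 0 => *; lra.
by apply/seteqP; split=> w /=; rewrite !in_itv/= !andbT ge_max lerBrDr => /andP.
Qed.

End Exponential.

(** * The modulus of an exponential symmetrizer *)

Section ExponentialSymmetrizer.
Context {d : measure_display} {T : measurableType d} {R : realType}.
Variable P : probability T R.
Implicit Types X Y Z : {RV P >-> R}.
Local Notation pr := (pr P).

(** The reflection identity at [h = 2 e], for a set symmetric about [e]: on
    [X < 2 e] the distance from [W] to [e] differs from [|Y|] by at most [e],
    and there [Y] is still independent of the conditioning. *)
Lemma exponential_symmetrizer_window X Y (lambda e t : R) :
  0 < lambda -> 0 < e -> exponential_rv X lambda ->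
  independent_symmetrizer X Y ->
  pr (Y @^-1` outside 0 (t + e)) <=
    pr ((X \+ Y : {RV P >-> R}) @^-1` outside e t) <=
    pr (Y @^-1` outside 0 (t - e)).
Proof.
move=> l0 e0 expX symm; set W : {RV P >-> R} := X \+ Y.
have h0 : 0 <= e *+ 2 by rewrite mulrn_wge0// ltW.
have mem := exponential_memoryless expX h0.
set theta := expR _ in mem.
have th0 : 0 <= theta by exact: expR_ge0.
have th1 : theta < 1.
  by rewrite -expR0 ltr_expR mulNr oppr_lt0 mulr_gt0// mulrn_wgt0.
have refl x : outside e t (e *+ 2 - x) <-> outside e t x.
  by rewrite /outside /= (_ : e *+ 2 - x - e = - (x - e)) ?normrN//; ring.
have mO (c s : R) : measurable (outside c s) by exact: measurable_outside.
have window := pr_reflection symm mem th0 (mO e t) refl.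
have X0 := exponential_lt0 expX.
have mXlt (x : R) : measurable (X @^-1` `]-oo, x[) by exact: measurable_pre.
have YX s : pr (X @^-1` `]-oo, e *+ 2[ `&` Y @^-1` outside 0 s) =
    (1 - theta) * pr (Y @^-1` outside 0 s).
  rewrite {1}/pr symm.1// fineM ?fin_num_measure//; last exact: measurable_pre.
  by rewrite -/(pr _) -/(pr _) (memoryless_at_pr_lt mem).
have close w : (0 <= X w < e *+ 2)%R ->
    `| (`|W w - e|) - (`|Y w - 0|) | <= e.
  move=> /andP[Xw0 Xwe]; apply: le_trans (ler_dist_dist _ _) _.
  rewrite /W /= (_ : _ - _ = X w - e); last by ring.
  by rewrite ler_norml; apply/andP; split; lra.
apply/andP; split.
  rewrite -(ler_pM2l (_ : 0 < 1 - theta)) ?subr_gt0// -window -YX.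
  rewrite -[leRHS]addr0 -[X in _ <= _ + X]X0.
  apply: le_prU => //.
  - by apply: measurable_preI.
  - by apply: measurable_preI.
  - move=> w [Xw Yw]; have [Xw0|Xw0] := leP 0 (X w); last first.
      by right; rewrite /= in_itv.
    left; split=> //; move: Xw Yw; rewrite /outside /= in_itv /= => Xw Yw.
    have := close w; rewrite Xw0 Xw => /(_ isT).
    by rewrite ler_norml => /andP[? _]; lra.
rewrite -(ler_pM2l (_ : 0 < 1 - theta)) ?subr_gt0// -window -YX.
rewrite -[leRHS]addr0 -[X in _ <= _ + X]X0.
apply: le_prU => //.
- by apply: measurable_preI.
- by apply: measurable_preI.
- move=> w [Xw Ww]; have [Xw0|Xw0] := leP 0 (X w); last first.
    by right; rewrite /= in_itv.
  left; split=> //; move: Xw Ww; rewrite /outside /= in_itv /= => Xw Ww.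
  have := close w; rewrite Xw0 Xw => /(_ isT).
  by rewrite ler_norml => /andP[_ ?]; move: Ww; rewrite /W /=; lra.
Qed.

Lemma le_pr_outside Z (c c' t s : R) : t + `|c - c'| <= s ->
  pr (Z @^-1` outside c s) <= pr (Z @^-1` outside c' t).
Proof.
move=> ts; apply: le_pr; try by apply: measurable_pre; exact: measurable_outside.
move=> w; rewrite /outside /= => sZ.
have := ler_normD (Z w - c') (c' - c); rewrite addrA subrK (distrC c' c).
by lra.
Qed.

(** [|Y|] and [|X + Y|] have the same law: let [e] tend to [0] in the window
    estimate. *)
Lemma exponential_symmetrizer_law X Y (lambda t : R) : 0 < lambda ->
  exponential_rv X lambda -> independent_symmetrizer X Y ->
  pr (Y @^-1` outside 0 t) = pr ((X \+ Y : {RV P >-> R}) @^-1` outside 0 t).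
Proof.
move=> l0 expX symm; apply/eqP; rewrite eq_le; apply/andP; split.
  apply: pr_outside_right_cont => e e0.
  have e20 : 0 < e / 2 by rewrite divr_gt0.
  have := exponential_symmetrizer_window (t + e / 2) l0 e20 expX symm.
  move=> /andP[+ _]; rewrite -addrA -splitr => /le_trans; apply.
  by apply: le_pr_outside; rewrite subr0 gtr0_norm.
apply: pr_outside_right_cont => e e0.
have e20 : 0 < e / 2 by rewrite divr_gt0.
have := exponential_symmetrizer_window (t + e / 2) l0 e20 expX symm.
move=> /andP[_]; rewrite addrK => /(le_trans _); apply.
apply: le_pr_outside.
by rewrite sub0r normrN gtr0_norm// -addrA -splitr.
Qed.

Lemma pr_ge_half Z (t : R) : symmetric_rv Z -> t < 0 ->
  1 <= 2 * pr (Z @^-1` `]t, +oo[).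
Proof.
move=> sym t0.
suff : pr setT <= pr (Z @^-1` `]t, +oo[) + pr (Z @^-1` `]t, +oo[).
  by rewrite pr_setT; lra.
rewrite -{2}(symmetric_rv_pr sym (measurable_itv _)).
apply: le_prU => //; first exact: measurable_pre.
  rewrite (_ : [set x | _] = `]-oo, - t[%classic); first exact: measurable_pre.
  by apply/seteqP; split=> x; rewrite /= !in_itv/= ?andbT => ?; lra.
move=> w _ /=; rewrite !in_itv/= !andbT.
by have [|] := ltP t (Z w); [left|right; lra].
Qed.

(** For nonnegative [t] this is the hazard bound of [X + Y].  It persists for
    negative [t], where the tail of the modulus is [1]: a symmetric variable
    exceeds a negative level with probability at least [1 / 2].  In particular
    [Y] has no atom at [0]. *)
Lemma exponential_symmetrizer_hazard X Y (lambda t h : R) : 0 < lambda ->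
  exponential_rv X lambda -> independent_symmetrizer X Y -> 0 <= h ->
  expR (- lambda * h) * pr (Y @^-1` outside 0 t) <=
  pr (Y @^-1` outside 0 (t + h)).
Proof.
move=> l0 expX symm h0.
have mem := exponential_memoryless expX h0.
rewrite !(exponential_symmetrizer_law _ l0 expX symm).
have [t0|t0] := leP 0 t; first exact: pr_outside_add mem (expR_ge0 _) h0 t0.
set W : {RV P >-> R} := X \+ Y; set theta := expR _ in mem *.
have th0 : 0 <= theta by exact: expR_ge0.
(* the modulus exceeds a negative level surely *)
apply: (@le_trans _ _ theta).
  rewrite -[leRHS]mulr1 ler_wpM2l// pr_le1//.
  by apply: measurable_pre; exact: measurable_outside.
have [th|th] := ltP (t + h) 0.
  rewrite (_ : outside 0 (t + h) = setT) ?preimage_setT ?pr_setT.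
    by rewrite -expR0 ler_expR mulNr oppr_le0 mulr_ge0// ltW.
  by rewrite -subTset => x _; rewrite /outside /=; exact: lt_le_trans th _.
rewrite (pr_outside _ symm.2 th) subr0 addr0.
have := pr_ge_half symm.2 t0; have := pr_gt_addl t symm.1 mem th0.
by rewrite -/W; nra.
Qed.

(** A density bound on half-open intervals extends to Borel sets, Lebesgue
    measure being the outer measure defined by covers with such intervals. *)
Lemma pr_le_lebesgue Y (D : set T) (C : R) (A : set R) :
  measurable D -> 0 <= C ->
  (forall a b, a < b -> pr (Y @^-1` `]a, b] `&` D) <= C * (b - a)) ->
  measurable A -> (lebesgue_measure A < +oo)%E ->
  pr (Y @^-1` A `&` D) <= C * fine (lebesgue_measure A).
Proof.
move=> mD C0 itvC mA Afin; apply/ler_addgt0Pr => e e0.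
have C1 : 0 < C + 1 by rewrite ltr_wpDl.
have Afn : lebesgue_measure A \is a fin_num by rewrite ge0_fin_numE.
have eC : 0 < e / (C + 1) by rewrite divr_gt0.
have [_ [F [mF AF]] <- Fe] := lb_ereal_inf_adherent eC Afn.
have mYF k : measurable (Y @^-1` F k `&` D).
  apply: measurableI => //; apply: measurable_pre.
  by apply: sub_sigma_algebra; exact: mF.
rewrite -lee_fin -prK; last by apply: measurableI => //; exact: measurable_pre.
apply: (@le_trans _ _ (\sum_(0 <= k <oo) P (Y @^-1` F k `&` D))%E).
  apply: measure_sigma_subadditive => //.
    by apply: measurableI => //; exact: measurable_pre.
  by move=> w [/AF[k _ Fk] Dw]; exists k.
apply: (@le_trans _ _ (\sum_(0 <= k <oo) (C%:E * wlength idfun (F k)))%E).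
  apply: lee_nneseries => // k _; have /ocitvP[->|[ab ab12 ->]] := mF k.
    by rewrite preimage_set0 set0I measure0 wlength0 mule0.
  rewrite wlength_itv_bnd; last exact: ltW.
  rewrite prK; last first.
    by apply: measurableI => //; exact: measurable_pre.
  by rewrite -EFinM lee_fin; exact: itvC.
rewrite nneseriesZl; last by move=> k _; exact: wlength_ge0.
apply: (@le_trans _ _ (C%:E * (lebesgue_measure A + (e / (C + 1))%:E))%E).
  by rewrite lee_wpmul2l// ltW.
rewrite -[X in (X + _)%E]fineK// -EFinD -EFinM lee_fin mulrDr lerD2l.
by rewrite mulrCA ger_pMr// ler_pdivrMr// mul1r lerDl.
Qed.

End ExponentialSymmetrizer.

(** * Laws whose modulus has a bounded hazard rate *)

Section Hazard.
Context {d : measure_display} {T : measurableType d} {R : realType}.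
Variable P : probability T R.
Implicit Types Y Z : {RV P >-> R}.
Local Notation pr := (pr P).

(** Integrated form of: the hazard rate of [|Y|] is at most [lambda].  Letting
    [t] range over all reals also forbids an atom at [0]. *)
Definition hazard_le Y (lambda : R) := forall t h, 0 <= h ->
  expR (- lambda * h) * pr (Y @^-1` outside 0 t) <= pr (Y @^-1` outside 0 (t + h)).

Let mout Y (t : R) : measurable (Y @^-1` outside 0 t).
Proof. by apply: measurable_pre; exact: measurable_outside. Qed.

Let out_anti Y (s t : R) : s <= t ->
  pr (Y @^-1` outside 0 t) <= pr (Y @^-1` outside 0 s).
Proof. by move=> st; apply: le_pr_outside; rewrite subrr normr0 addr0. Qed.

Lemma measurable_ring (a b : R) : measurable [set x : R | a <= `|x| <= b].
Proof.
have -> : [set x : R | a <= `|x| <= b] = (fun x => `|x|) @^-1` `[a, b].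
  by apply/seteqP; split=> x; rewrite /= in_itv.
rewrite -[X in measurable X]setTI.
suff: measurable_fun setT (fun x : R => `|x|) by apply.
exact: measurableT_comp.
Qed.

Lemma hazard_ring Y (lambda s a b : R) : 0 < lambda -> hazard_le Y lambda ->
  a <= b ->
  pr (Y @^-1` [set y | a <= `|y| <= b] `&` Y @^-1` outside 0 s) <=
  lambda * pr (Y @^-1` outside 0 s) * (b - a).
Proof.
move=> l0 haz ab; set C := lambda * _.
have C0 : 0 <= C by rewrite mulr_ge0 ?pr_ge0// ltW.
have mE : measurable (Y @^-1` [set y | a <= `|y| <= b] `&` Y @^-1` outside 0 s).
  by apply: measurable_preI; [exact: measurable_ring|exact: measurable_outside].
apply/ler_addgt0Pr => e e0.
have eC : 0 < e / (C + 1) by rewrite divr_gt0// ltr_wpDl.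
suff step : pr (Y @^-1` [set y | a <= `|y| <= b] `&` Y @^-1` outside 0 s) <=
    C * (b - a + e / (C + 1)).
  apply: le_trans step _; rewrite mulrDr lerD2l mulrCA ger_pMr//.
  by rewrite ler_pdivrMr ?ltr_wpDl// mul1r lerDl.
set e' := e / _ in eC *.
(* Starting the shell slightly below [a] turns the closed condition [a <= |y|]
   into the open one that tails control. *)
pose c := Num.max s (a - e').
have [sc ac] : s <= c /\ a - e' <= c by rewrite /c !le_max !lexx orbT.
have subc : Y @^-1` [set y | a <= `|y| <= b] `&` Y @^-1` outside 0 s `<=`
    Y @^-1` outside 0 c `&` ~` (Y @^-1` outside 0 b).
  move=> w [/= /andP[aw wb]]; rewrite /outside /= subr0 => sw; split.
    by rewrite /c gt_max sw/=; lra.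
  by apply/negP; rewrite -leNgt.
have [cb|bc] := leP c b; last first.
  rewrite (_ : _ `&` _ = set0); first by rewrite pr_set0 mulr_ge0//; lra.
  rewrite -subset0 => w /subc[]; rewrite /outside /= subr0 => cw.
  by move/negP; rewrite -leNgt; lra.
have mcb := measurableI _ _ (mout Y c) (measurableC (mout Y b)).
apply: le_trans (le_pr P mE mcb subc) _.
have := prID P (mout Y c) (mout Y b).
rewrite setIidr; last first.
  by move=> w; rewrite /outside /=; exact: le_lt_trans.
have := haz c (b - c); rewrite addrCA subrr addr0 subr_ge0 => /(_ cb).
have := expR_ge1Dx (- lambda * (b - c)).
have := out_anti Y sc; rewrite /C; have := pr_ge0 P (Y @^-1` outside 0 c).
set E := expR _; set Tc := pr (Y @^-1` outside 0 c).
set Ts := pr (Y @^-1` outside 0 s); set Tb := pr (Y @^-1` outside 0 b).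
set m := pr _ => Tc0 Tcs E1 ETb cut.
have -> : m = Tc - Tb by rewrite cut; ring.
apply: (@le_trans _ _ (lambda * Tc * (b - c))); first by nra.
by apply: ler_pM; rewrite ?ler_wpM2l ?mulr_ge0 ?subr_ge0 ?(ltW l0)//; lra.
Qed.

(** An interval around [0] contributes to the modulus from both sides; the two
    lengths add up to its length. *)
Lemma hazard_itv Y (lambda s a b : R) : 0 < lambda -> hazard_le Y lambda ->
  a < b ->
  pr (Y @^-1` `]a, b] `&` Y @^-1` outside 0 s) <=
  lambda * pr (Y @^-1` outside 0 s) * (b - a).
Proof.
move=> l0 haz ab; set C := lambda * _.
pose ring a b := Y @^-1` [set y | a <= `|y| <= b] `&` Y @^-1` outside 0 s.
have mring x y : measurable (ring x y).
  by apply: measurable_preI; [exact: measurable_ring|exact: measurable_outside].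
have mab : measurable (Y @^-1` `]a, b] `&` Y @^-1` outside 0 s).
  by apply: measurable_preI => //; exact: measurable_outside.
have ringC x y : x <= y -> pr (ring x y) <= C * (y - x).
  exact: hazard_ring.
have [a0|a0] := leP 0 a.
  apply: le_trans (ringC _ _ (ltW ab)); apply: le_pr => //.
  move=> w [/=]; rewrite in_itv/= => /andP[aw wb] sw; split=> //=.
  by rewrite ger0_norm; lra.
have [b0|b0] := leP b 0.
  rewrite (_ : b - a = - a - - b); last by ring.
  apply: le_trans (ringC _ _ _); last by lra.
  apply: le_pr => // w [/=]; rewrite in_itv/= => /andP[aw wb] sw; split=> //=.
  by rewrite ler0_norm; lra.
apply: (@le_trans _ _ (pr (ring 0 b) + pr (ring 0 (- a)))).
  apply: le_prU => // w [/=]; rewrite in_itv/= => /andP[aw wb] sw.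
  have [w0|w0] := leP 0 (Y w); [left|right]; split => //=.
    by rewrite ger0_norm// w0.
  by rewrite ltr0_norm//; lra.
rewrite (_ : C * (b - a) = C * (b - 0) + C * (- a - 0)); last by ring.
by apply: lerD; apply: ringC; lra.
Qed.

Lemma hazard_le_lebesgue Y (lambda s : R) (A : set R) : 0 < lambda ->
  hazard_le Y lambda -> measurable A -> (lebesgue_measure A < +oo)%E ->
  pr (Y @^-1` A `&` Y @^-1` outside 0 s) <=
  lambda * pr (Y @^-1` outside 0 s) * fine (lebesgue_measure A).
Proof.
move=> l0 haz mA Afin; apply: pr_le_lebesgue => //.
  by rewrite mulr_ge0 ?pr_ge0// ltW.
by move=> a b; exact: hazard_itv.
Qed.

(** [(1 + k * x) * (1 - x) >= 1] exactly because [x <= 1 - k^-1]. *)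
Lemma expR_le_onem (k x : R) : 1 < k -> 0 <= x <= 1 - k^-1 ->
  expR (- (k * x)) <= 1 - x.
Proof.
move=> k1 /andP[x0 xk]; have k0 : 0 < k by lra.
have kx : k * x <= k - 1.
  by have := ler_wpM2l (ltW k0) xk; rewrite mulrBr mulr1 divff ?gt_eqF.
have := expR_ge1Dx (k * x); have := expRxMexpNx_1 (k * x).
have := expR_gt0 (k * x); have := expR_gt0 (- (k * x)).
set E := expR (k * x); set F := expR _ => F0 E0 EF E1.
have x1 : 0 <= 1 - x by nra.
have : 1 <= (1 - x) * E by nra.
by nra.
Qed.

Lemma outside_vanish Y (e : R) : 0 < e ->
  exists t, pr (Y @^-1` outside 0 t) <= e.
Proof.
move=> e0.
have mf : (fun w => `|Y w - 0|) \in mfun.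
  apply/mem_set; apply: measurableT_comp => //.
  by apply: measurable_funB.
pose Z : {RV P >-> R} := mfun_Sub mf.
have := @cvg_ccdfy0 _ _ _ P Z.
move/fine_cvg => /cvgr_lt /(_ _ e0) [M [_ MZ]]; exists (M + 1).
have := MZ (M + 1); rewrite ltrDl ltr01 => /(_ isT) /ltW.
apply: le_trans; rewrite le_eqVlt; apply/orP; left; apply/eqP.
rewrite /= /ccdf /distribution /pushforward -/(pr _); congr pr.
by apply/seteqP; split=> w; rewrite /outside /= in_itv/= andbT.
Qed.

(** Discrete Gronwall argument on the levels [-1 + i * de].  If [m] is the mass
    of [A] up to one level, the next slice [D] of [A] has mass at most
    [lambda * (1 - m) * |D|], so the uncaptured mass [1 - m] keeps at least the
    fraction [1 - lambda * |D|].  That fraction is at least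
    [expR (- (k * (lambda * |D|)))] once the mesh [de] is so fine that
    [lambda * |D| <= 1 - k^-1], and the measures of the slices add up. *)
Lemma hazard_grid_bound Y (lambda k : R) (A : set R) : 0 < lambda -> 1 < k ->
  hazard_le Y lambda -> measurable A -> (lebesgue_measure A < +oo)%E ->
  forall t, expR (- (k * (lambda * fine (lebesgue_measure A)))) <=
    1 - pr (Y @^-1` (A `\` outside 0 t)).
Proof.
move=> l0 k1 haz mA Afin t.
have k0 : 0 < k by lra.
pose eta := 1 - k^-1.
have eta0 : 0 < eta by rewrite subr_gt0 invf_lt1.
(* a slice lies in two intervals of length [de], whence the factor [2] *)
pose de := eta / (lambda *+ 2).
have de0 : 0 < de by rewrite divr_gt0// mulrn_wgt0.
(* At the negative starting level nothing has been captured yet. *)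
pose tt (i : nat) : R := -1 + i%:R * de.
pose B i := A `\` outside 0 (tt i).
have mO s : measurable (outside 0 s : set R) by exact: measurable_outside.
have mB i : measurable (B i) by exact: measurableD.
have finI (S : set R) : measurable S -> S `<=` A ->
    lebesgue_measure S \is a fin_num.
  move=> mS SA; rewrite ge0_fin_numE//; apply: le_lt_trans Afin.
  by apply: le_measure; rewrite ?inE.
have grid i : expR (- (k * (lambda * fine (lebesgue_measure (B i))))) <=
    1 - pr (Y @^-1` B i).
  elim: i => [|i IHi].
    have -> : B 0 = set0.
      rewrite -subset0 => x [_]; rewrite /outside /tt /= mul0r addr0; apply.
      by rewrite (lt_le_trans _ (normr_ge0 _))// oppr_lt0.
    by rewrite preimage_set0 pr_set0 subr0 measure0 !mulr0 oppr0 expR0.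
  pose D := A `&` (outside 0 (tt i) `\` outside 0 (tt i.+1)).
  have mD : measurable D by apply: measurableI => //; exact: measurableD.
  have ti : tt i.+1 = tt i + de by rewrite /tt -natr1; ring.
  have BD : B i.+1 = B i `|` D.
    apply/seteqP; split=> x.
      move=> [Ax nx]; have [ox|ox] := pselect (outside 0 (tt i) x).
        by right; split.
      by left; split.
    case=> [[Ax nx]|[Ax [_ nx]]]; split=> // ox; apply: nx.
    by move: ox; rewrite /outside /= ti; apply: le_lt_trans; rewrite lerDl ltW.
  have BD0 : B i `&` D = set0.
    by rewrite -subset0 => x [[_ nx] [_ [ox _]]].
  have -> : pr (Y @^-1` B i.+1) = pr (Y @^-1` B i) + pr (Y @^-1` D).
    rewrite BD preimage_setU prU//; try exact: measurable_pre.
    by rewrite -preimage_setI BD0 preimage_set0.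
  have BA : B i `<=` A by move=> x [].
  have DA : D `<=` A by move=> x [].
  have -> : fine (lebesgue_measure (B i.+1)) =
      fine (lebesgue_measure (B i)) + fine (lebesgue_measure D).
    have -> : lebesgue_measure (B i.+1) =
        (lebesgue_measure (B i) + lebesgue_measure D)%E.
      by rewrite BD; exact (measureU lebesgue_measure (mB i) mD BD0).
    by rewrite fineD// finI.
  have prD : pr (Y @^-1` D) <=
      lambda * pr (Y @^-1` outside 0 (tt i)) * fine (lebesgue_measure D).
    have := hazard_le_lebesgue (tt i) l0 haz mD.
    rewrite -preimage_setI (_ : D `&` _ = D); last first.
      by rewrite setIidl// => x [_ []].
    by apply; rewrite -ge0_fin_numE// finI.
  have tail : pr (Y @^-1` outside 0 (tt i)) <= 1 - pr (Y @^-1` B i).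
    rewrite lerBrDr -prU//; last 2 first.
    - exact: measurable_pre.
    - by rewrite -preimage_setI setICA setICr setI0 preimage_set0.
    by rewrite pr_le1//; apply: measurableU => //; exact: measurable_pre.
  have D0 : 0 <= fine (lebesgue_measure D) by rewrite fine_ge0.
  have Dsmall : lambda * fine (lebesgue_measure D) <= eta.
    have : fine (lebesgue_measure D) <= de *+ 2.
      rewrite -lee_fin fineK ?finI// mulr2n EFinD.
      have itvE x y : x <= y -> lebesgue_measure (`[x, y]%classic : set R) = (y - x)%:E.
        move=> xy; rewrite lebesgue_measure_itv/= lte_fin.
        have [//|yx] := ltP x y; rewrite (_ : y = x) ?subrr//.
        by apply/eqP; rewrite eq_le yx.
      have itvde x : lebesgue_measure (`[x, x + de]%classic : set R) = de%:E.
        by rewrite itvE ?lerDl ?ltW// addrAC subrr add0r.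
      rewrite -{1}(itvde (tt i)) -(itvde (- tt i.+1)).
      apply: (@le_trans _ _ (lebesgue_measure
        (`[tt i, tt i + de] `|` `[- tt i.+1, - tt i.+1 + de] : set R))).
        apply: le_measure; rewrite ?inE//; first exact: measurableU.
        move=> x [_ []]; rewrite /outside /= subr0 => ox /negP; rewrite -leNgt => nx.
        move: ox nx; rewrite ti; have [x0|x0] := leP 0 x; [left|right];
          rewrite /= in_itv/=.
          by move: ox nx; rewrite ger0_norm//; lra.
        by move: ox nx; rewrite ltr0_norm//; lra.
      exact (measureU2 lebesgue_measure (measurable_itv _) (measurable_itv _)).
    rewrite /de => h; apply: le_trans (ler_wpM2l (ltW l0) h) _.
    by rewrite le_eqVlt; apply/orP; left; apply/eqP; field; lra.
  rewrite mulrDr mulrDr opprD expRD.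
  have := @expR_le_onem k (lambda * fine (lebesgue_measure D)) k1.
  rewrite Dsmall mulr_ge0 ?(ltW l0)// => /(_ isT) factor.
  apply: le_trans (ler_pM (expR_ge0 _) (expR_ge0 _) IHi factor) _.
  set b := fine _ in prD factor *; set m := pr (Y @^-1` B i) in IHi tail *.
  have : lambda * pr (Y @^-1` outside 0 (tt i)) * b <= lambda * (1 - m) * b.
    by rewrite ler_wpM2r// ler_wpM2l// ltW.
  by move: prD; lra.
pose i := (Num.truncn ((`|t| + 1) / de)).+1.
have tti : t <= tt i.
  have := truncnS_gt ((`|t| + 1) / de); rewrite -/i ltr_pdivrMr//.
  by rewrite /tt; have := ler_norm t; lra.
apply: (@le_trans _ _ (1 - pr (Y @^-1` B i))); last first.
  rewrite lerD2l lerN2; apply: le_pr; try exact: measurable_pre.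
    by apply: measurable_pre; exact: measurableD.
  move=> w [Aw nw]; split=> // ow; apply: nw; move: ow.
  by rewrite /outside /=; exact: le_lt_trans.
apply: le_trans (grid i); rewrite ler_expR lerN2 ler_wpM2l ?(ltW k0)//.
have BA : B i `<=` A by move=> x [].
rewrite ler_wpM2l ?(ltW l0)// fine_le ?finI//.
by apply: le_measure; rewrite ?inE//; exact: mB.
Qed.

(** The radius of the captured region tends to infinity, then [k] to [1]. *)
Lemma hazard_bound Y (lambda : R) (A : set R) : 0 < lambda ->
  hazard_le Y lambda -> measurable A -> (lebesgue_measure A < +oo)%E ->
  pr (Y @^-1` A) <= 1 - expR (- lambda * fine (lebesgue_measure A)).
Proof.
move=> l0 haz mA Afin; set a := fine _.
have a0 : 0 <= a by rewrite fine_ge0.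
have la0 : 0 <= lambda * a by rewrite mulr_ge0// ltW.
have mYA : measurable (Y @^-1` A) by exact: measurable_pre.
have atk k : 1 < k -> pr (Y @^-1` A) <= 1 - expR (- (k * (lambda * a))).
  move=> k1; apply/ler_addgt0Pr => e e0.
  have [t te] := outside_vanish Y e0.
  have := hazard_grid_bound l0 k1 haz mA Afin t; rewrite -/a => grid.
  have : pr (Y @^-1` A) <=
      pr (Y @^-1` (A `\` outside 0 t)) + pr (Y @^-1` outside 0 t).
    apply: le_prU => //.
      by apply: measurable_pre; apply: measurableD => //; exact: measurable_outside.
    move=> w Aw; have [ow|ow] := pselect (outside 0 t (Y w)); first by right.
    by left.
  by lra.
apply/ler_addgt0Pr => e e0.
have ea : 0 < e / (lambda * a + 1) by rewrite divr_gt0// ltr_wpDl.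
have := atk (1 + e / (lambda * a + 1)); rewrite ltrDl => /(_ ea).
rewrite mulrDl mul1r opprD expRD mulNr.
set x := _ * (lambda * a).
have xe : x <= e.
  by rewrite /x mulrAC ler_pdivrMr ?ltr_wpDl// ler_pM2l//; lra.
have := expR_ge1Dx (- x); have := expR_ge0 (- (lambda * a)).
have : expR (- (lambda * a)) <= 1 by rewrite -expR0 ler_expR oppr_le0.
have x0 : 0 <= x by rewrite mulr_ge0// ltW.
by set E := expR (- (lambda * a)); nra.
Qed.

End Hazard.

(** * Independent copies of the opposite variable *)

Section Copies.
Context {d : measure_display} {T : measurableType d} {R : realType}.
Variable P : probability T R.
Implicit Types X Y : {RV P >-> R}.
Local Notation pr := (pr P).

Lemma independent_copy_opp_pr X Y (S : set R) : independent_copy_opp X Y ->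
  measurable S -> P (Y @^-1` S) = P (X @^-1` [set x | S (- x)]).
Proof. by move=> [_ copy] mS; exact: copy. Qed.

Lemma exponential_copy_segment X Y (lambda a : R) :
  exponential_rv X lambda -> independent_copy_opp X Y -> 0 <= a ->
  distribution P Y `[- a, 0] = (1 - expR (- lambda * a))%:E.
Proof.
move=> expX copy a0; rewrite /distribution /pushforward.
rewrite (independent_copy_opp_pr copy)// -(exponential_segment expX a0).
rewrite -prK; last exact: measurable_pre.
congr (P (_ @^-1` _)); apply/seteqP.
by split=> x; rewrite /= !in_itv/= oppr_le0 lerN2 andbC.
Qed.

Let mseg m : measurable [set x : R | exists2 k, (k < m)%N & x = k%:R].
Proof.
have -> : [set x : R | exists2 k, (k < m)%N & x = k%:R] =
    \bigcup_(k in `I_m) [set k%:R].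
  by apply/seteqP; split=> x [k km xk]; exists k.
exact: bigcup_measurable.
Qed.

Lemma geometric_initial_segment X (p : R) n : geometric_rv X p ->
  pr (X @^-1` [set x | exists2 k, (k < n)%N & x = k%:R]) = 1 - (1 - p) ^+ n.
Proof.
move=> geo; elim: n => [|n IHn].
  rewrite expr0 subrr (_ : [set x | _] = set0) ?preimage_set0 ?pr_set0//.
  by rewrite -subset0 => x [].
rewrite (_ : [set x | _] =
  [set x | exists2 k, (k < n)%N & x = k%:R] `|` [set n%:R]); last first.
  apply/seteqP; split=> x.
    move=> [k + xk]; rewrite ltnS leq_eqVlt => /predU1P[kn|kn].
      by right; rewrite /= xk kn.
    by left; exists k.
  by move=> [[k kn ->]|->]; [exists k => //; exact: ltnW|exists n].
rewrite preimage_setU prU; try exact: measurable_pre.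
  by rewrite IHn -[pr (X @^-1` [set _])]/(pmf X n%:R) geo exprS; ring.
rewrite -preimage_setI (_ : _ `&` _ = set0) ?preimage_set0//.
rewrite -subset0 => x [[k kn ->]] /= /eqP; rewrite eqr_nat => /eqP kn'.
by rewrite kn' ltnn in kn.
Qed.

Lemma geometric_copy_integer X Y (p : R) : 0 < p < 1 -> geometric_rv X p ->
  independent_copy_opp X Y -> integer_valued Y.
Proof.
move=> p01 geo copy.
have mN := measurable_opp (@measurable_natural_points R).
have mYN := measurable_pre Y mN.
exists (~` (Y @^-1` [set x : R | natural_points (- x)])); split.
- exact: measurableC.
- rewrite probability_setC// (independent_copy_opp_pr copy)//.
  have -> : [set x : R | [set x | natural_points (- x)] (- x)] = natural_points.
    by apply/seteqP; split=> x /=; rewrite opprK.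
  by rewrite (geometric_nat p01 geo) subee.
- move=> w /= nint [k _ Yk]; apply: nint.
  by rewrite -[Y w]opprK Yk rpredN natr_int.
Qed.

Lemma geometric_copy_segment X Y (p : R) n : geometric_rv X p ->
  independent_copy_opp X Y ->
  exists A : {fset int}, #|` A| = n /\
    distribution P Y [set k%:~R | k in [set` A]] = (1 - (1 - p) ^+ n)%:E.
Proof.
move=> geo copy.
exists [fset (- (k%:Z))%R | k in iota 0 n]%fset; split.
  rewrite card_imfset /=; last by move=> i j /oppr_inj [].
  by rewrite undup_id ?iota_uniq// size_iota.
rewrite /distribution /pushforward (independent_copy_opp_pr copy); last first.
  exact: measurable_int_fset.
rewrite -(geometric_initial_segment n geo) -prK; last exact: measurable_pre.
congr (P (_ @^-1` _)); apply/seteqP; split=> x.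
  move=> [k /= /imfsetP[/= j]]; rewrite mem_iota add0n => jn -> /eqP.
  by rewrite rmorphN/= eqr_opp => /eqP <-; exists j.
move=> [k kn ->]; exists (- (k%:Z)); last by rewrite rmorphN.
by apply/imfsetP; exists k => //=; rewrite mem_iota.
Qed.

End Copies.

Lemma opp_copy_exists (R : realType) (mu : probability R R) :
  exists (d : measure_display) (T : measurableType d)
    (P : probability T R) (X Y : {RV P >-> R}),
  (forall A : set R, measurable A -> distribution P X A = mu A) /\
  independent_copy_opp X Y.
Proof.
pose P : probability (R * R)%type R := (mu \x mu)%E.
have mX : (fst : R * R -> R) \in mfun by apply/mem_set; exact: measurable_fst.
have mY : (fun z : R * R => - z.2) \in mfun.
  by apply/mem_set; apply: measurable_funN; exact: measurable_snd.
have mN (A : set R) : measurable A -> measurable [set x : R | A (- x)].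
  exact: measurable_opp.
have PE (A B : set R) : measurable A -> measurable B ->
    P (A `*` B) = (mu A * mu B)%E.
  by move=> mA mB; rewrite /P /= product_measure1E.
have fstE (A : set R) : measurable A -> P (fst @^-1` A) = mu A.
  move=> mA; rewrite (_ : fst @^-1` A = A `*` setT).
    by rewrite PE// probability_setT mule1.
  by apply/seteqP; split=> z //= [].
have sndE (A : set R) : measurable A -> P (snd @^-1` A) = mu A.
  move=> mA; rewrite (_ : snd @^-1` A = setT `*` A).
    by rewrite PE// probability_setT mul1e.
  by apply/seteqP; split=> z //= [].
pose X : {RV P >-> R} := mfun_Sub mX.
pose Y : {RV P >-> R} := mfun_Sub mY.
exists _, _, P, X, Y; split=> [A mA|]; first exact: fstE.
split=> [A B mA mB|A mA].
  rewrite [RHS](_ : _ = P (fst @^-1` A) * P (snd @^-1` [set x : R | B (- x)%R]))%E//.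
  rewrite fstE// sndE; last exact: mN.
  by rewrite -PE//; last exact: mN.
rewrite /distribution /pushforward.
transitivity (P (snd @^-1` [set x | A (- x)])); first by [].
rewrite sndE; last exact: mN.
by rewrite -fstE//; exact: mN.
Qed.

Lemma exponential_copy_exists (R : realType) (lambda : R) : 0 < lambda ->
  exists (d : measure_display) (T : measurableType d)
    (P : probability T R) (X Y : {RV P >-> R}),
  exponential_rv X lambda /\ independent_copy_opp X Y.
Proof.
move=> l0; pose mu : probability (measurableTypeR R) R := exponential_prob lambda.
have mid : (idfun : measurableTypeR R -> R) \in mfun.
  by apply/mem_set; exact: measurable_id.
exact: (opp_copy_exists (distribution (mu l0) (mfun_Sub mid))).
Qed.

(** The integer part of an exponential variable of rate [- ln (1 - p)] is
    geometric of parameter [p]. *)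
Lemma geometric_copy_exists (R : realType) (p : R) : 0 < p < 1 ->
  exists (d : measure_display) (T : measurableType d)
    (P : probability T R) (X Y : {RV P >-> R}),
  geometric_rv X p /\ independent_copy_opp X Y.
Proof.
move=> /andP[p0 p1]; pose lambda := - ln (1 - p).
have q0 : 0 < 1 - p by lra.
have l0 : 0 < lambda by rewrite oppr_gt0 ln_lt0//; lra.
have [d [T [P [X [_ [expX _]]]]]] := exponential_copy_exists l0.
have mF : (fun w => (Num.floor (X w))%:~R : R) \in mfun.
  have mfl : measurable_fun setT (fun x : R => (Num.floor x)%:~R : R).
    by apply: nondecreasing_measurable => // x y xy; rewrite ler_int le_floor.
  by apply/mem_set; exact: (measurableT_comp mfl).
pose F : {RV P >-> R} := mfun_Sub mF.
have [d' [T' [P' [X' [Y' [X'F copy]]]]]] := opp_copy_exists (distribution P F).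
exists d', T', P', X', Y'; split=> // k.
rewrite /pmf -[P' _]/(distribution P' X' [set k%:R]) X'F//.
have expk n : expR (- lambda * n%:R) = (1 - p) ^+ n.
  by rewrite opprK mulrC expRM_natl lnK.
have tail n : pr P (X @^-1` `[n%:R, +oo[) = (1 - p) ^+ n.
  by rewrite (exponential_tail _ expX) max_l ?ler0n.
have := prID P (measurable_pre X (measurable_itv `[k%:R, +oo[))
  (measurable_pre X (measurable_itv `[k.+1%:R, +oo[)).
rewrite setIidr; last first.
  move=> w /=; rewrite !in_itv/= !andbT; apply: le_trans.
  by rewrite ler_nat.
rewrite !tail => cut.
transitivity (pr P (X @^-1` `[k%:R, +oo[ `&` ~` (X @^-1` `[k.+1%:R, +oo[))).
  congr (fine (P _)); apply/seteqP; split=> w /=; rewrite !in_itv/= !andbT.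
    move=> /eqP; rewrite -[k%:R]/(k%:Z%:~R) eqr_int => /eqP fk.
    have := floor_itv (X w); rewrite fk intrD => /andP[? ?].
    by split=> //; apply/negP; rewrite -ltNge -natr1.
  move=> [kX /negP]; rewrite -ltNge => Xk.
  by rewrite (@floor_def _ _ k)// kX intrD natr1.
by move: cut; rewrite exprS; lra.
Qed.

Theorem theorem1p2 (R : realType) :
  (forall lambda : R, 0 < lambda ->
    [/\ (forall (d : measure_display) (T : measurableType d)
            (P : probability T R) (X Y : {RV P >-> R}),
          exponential_rv X lambda -> independent_symmetrizer X Y ->
          forall A : set R, measurable A -> (lebesgue_measure A < +oo)%E ->
            (distribution P Y A <=
              (1 - expR (- lambda * fine (lebesgue_measure A)))%:E)%E),
        (forall (d : measure_display) (T : measurableType d)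
            (P : probability T R) (X Y : {RV P >-> R}),
          exponential_rv X lambda -> independent_copy_opp X Y ->
          independent_symmetrizer X Y /\
          forall a : R, 0 <= a ->
            exists A : set R, [/\ measurable A, lebesgue_measure A = a%:E &
              distribution P Y A = (1 - expR (- lambda * a))%:E])
      & (exists (d : measure_display) (T : measurableType d)
            (P : probability T R) (X Y : {RV P >-> R}),
          exponential_rv X lambda /\ independent_copy_opp X Y)])
  /\
  (forall p q : R, 0 < p < 1 -> q = 1 - p ->
    [/\ (forall (d : measure_display) (T : measurableType d)
            (P : probability T R) (X Y : {RV P >-> R}),
          geometric_rv X p -> independent_symmetrizer X Y ->
          integer_valued Y ->
          forall A : {fset int},
            (distribution P Y [set k%:~R | k in [set` A]] <=
              (1 - q ^+ #|` A|)%:E)%E),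
        (forall (d : measure_display) (T : measurableType d)
            (P : probability T R) (X Y : {RV P >-> R}),
          geometric_rv X p -> independent_copy_opp X Y ->
          [/\ independent_symmetrizer X Y, integer_valued Y &
            forall n : nat, exists A : {fset int}, #|` A| = n /\
              distribution P Y [set k%:~R | k in [set` A]] =
                (1 - q ^+ n)%:E])
      & (exists (d : measure_display) (T : measurableType d)
            (P : probability T R) (X Y : {RV P >-> R}),
          geometric_rv X p /\ independent_copy_opp X Y)]).
Proof.
split.
  move=> lambda l0; split; last exact: exponential_copy_exists.
    move=> d T P X Y expX symm A mA Afin.
    rewrite /distribution /pushforward prK; last exact: measurable_pre.
    rewrite lee_fin; apply: hazard_bound => // t h h0.
    exact: (exponential_symmetrizer_hazard t l0 expX symm h0).
  move=> d T P X Y expX copy; split.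
    exact: independent_copy_opp_symmetrizer.
  move=> a a0; exists `[- a, 0]%classic; split=> //.
    rewrite lebesgue_measure_itv/= lte_fin oppr_lt0 -EFinD sub0r opprK.
    by move: a0; rewrite le_eqVlt => /predU1P[<-|->] //; rewrite ltxx.
  exact: exponential_copy_segment expX copy a0.
move=> p q p01 ->; split; last exact: geometric_copy_exists.
  move=> d T P X Y geo symm _ A.
  rewrite /distribution /pushforward prK ?lee_fin.
    exact: geometric_symmetrizer_bound.
  by apply: measurable_pre; exact: measurable_int_fset.
move=> d T P X Y geo copy; split.
- exact: independent_copy_opp_symmetrizer.
- exact: geometric_copy_integer geo copy.
- by move=> n; exact: geometric_copy_segment.
Qed.
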